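(* Let $x_0,x_1,\dots$ be a sequence of integers. For each $n\ge 0$ set $F_n(m)=0$ for integers $m<x_n$, prescribe initial values $F_n(x_n)$, and for $m>x_n$ define $F_n(m)$ recursively by $$F_n(m)=F_n(m-1)+\sum_{i=1}^{n}\sum_{j}a_{i,j}F_{n-i}(m-b_{i,j}),$$ where the $a_{i,j}$ are constants, the $b_{i,j}$ are integers, and $\sum_j a_{1,j}\neq 0$. Suppose $F_0(m)=c\neq 0$ for all $m\ge x_0$, and suppose that for each $j$ we have $b_{i,j}\le x_n-x_{n-i}+1$ for all $n\ge 1$ and $i=1,\dots,n$. Then there exists a polynomial sequence $(f_n(x))_{n\ge 0}$ with $\deg f_n=n$ such that $F_n(m)=f_n(m)$ for all integers $m\ge x_n$ and all $n\ge 0$. *)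

(* Defs.v *)
From mathcomp Require Export all_boot all_order all_algebra.

(* Main.v *)
Require Import Defs.
From mathcomp Require Import all_boot all_order all_algebra.
From mathcomp Require Import ring zify.

(** The recurrence says that the backward difference of F_n is a combination
    of translates of the F_(n-i), and the bound on b_(i,j) keeps every argument
    in the range where F_(n-i) already agrees with f_(n-i).  In characteristic
    zero every polynomial g is a backward difference of a polynomial of degree
    deg g + 1.  The combination has degree exactly n - 1, since its coefficient
    of degree n - 1 comes from the terms i = 1 only and equals
    (sum_j a_(1,j)) * lead_coef f_(n-1). *)

Set Implicit Arguments.
Unset Strict Implicit.
Unset Printing Implicit Defensive.

Import Order.TTheory GRing.Theory Num.Theory.
Local Open Scope ring_scope.

Lemma size_sum_leq (R : nzSemiRingType) (I : Type) (r : seq I) (P : pred I)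
    (p : I -> {poly R}) n :
    (forall i, P i -> (size (p i) <= n)%N) ->
  (size (\sum_(i <- r | P i) p i)%R <= n)%N.
Proof.
move=> le_p_n; apply: (big_ind (fun q : {poly R} => size q <= n)%N) => //.
  by rewrite size_poly0.
move=> p1 p2 le1 le2.
by rewrite (leq_trans (size_polyD _ _)) // geq_max le1.
Qed.

Section PolyTranslate.

Variable R : idomainType.
Implicit Types (p : {poly R}) (c : R).

Lemma size_comp_XsubC p c : size (p \Po ('X - c%:P)) = size p.
Proof. by rewrite size_comp_poly2 // size_XsubC. Qed.

Lemma lead_coef_comp_XsubC p c : lead_coef (p \Po ('X - c%:P)) = lead_coef p.
Proof.
by rewrite lead_coef_comp ?size_XsubC // lead_coefXsubC expr1n mulr1.
Qed.

Lemma horner_comp_XsubC p c y : (p \Po ('X - c%:P)).[y] = p.[y - c].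
Proof. by rewrite horner_comp hornerXsubC. Qed.

End PolyTranslate.

Section BackwardDifference.

Variable K : fieldType.
Implicit Types p q g : {poly K}.

Definition bdiff p := p - (p \Po ('X - 1%:P)).

Lemma bdiffD p q : bdiff (p + q) = bdiff p + bdiff q.
Proof. by rewrite /bdiff comp_polyD; ring. Qed.

Lemma bdiffZ c p : bdiff (c *: p) = c *: bdiff p.
Proof. by rewrite /bdiff comp_polyZ scalerBr. Qed.

Lemma bdiffC c : bdiff c%:P = 0.
Proof. by rewrite /bdiff comp_polyC subrr. Qed.

Lemma horner_bdiff p y : (bdiff p).[y] = p.[y] - p.[y - 1].
Proof. by rewrite /bdiff hornerD hornerN horner_comp_XsubC. Qed.

(* Factoring 'X^k.+1 - ('X - 1)^k.+1 leaves a sum of k.+1 monic terms of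
   degree k. *)
Lemma bdiffXn k :
  bdiff 'X^(k.+1) = \sum_(i < k.+1) 'X^(k - i) * ('X - 1%:P) ^+ i.
Proof.
rewrite /bdiff comp_Xn_poly subrXX.
by rewrite (_ : 'X - ('X - 1%:P) = 1) ?mul1r //; ring.
Qed.

Lemma size_bdiffXn_term k (i : 'I_k.+1) :
  size ('X^(k - i) * ('X - 1%:P) ^+ i : {poly K}) = k.+1.
Proof.
rewrite size_Mmonic ?monic_exp ?monicXsubC ?monicXn ?monic_neq0 ?monicXn //.
rewrite size_polyXn size_exp_XsubC.
by have := ltn_ord i; lia.
Qed.

Lemma size_bdiffXn k : (size (bdiff 'X^(k.+1)) <= k.+1)%N.
Proof.
rewrite bdiffXn; apply: size_sum_leq => i _.
by rewrite size_bdiffXn_term.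
Qed.

Lemma coef_bdiffXn k : (bdiff 'X^(k.+1))`_k = k.+1%:R.
Proof.
rewrite bdiffXn coef_sum (eq_bigr (fun=> 1)) => [|i _].
  by rewrite sumr_const card_ord.
have /monicP : ('X^(k - i) * ('X - 1%:P) ^+ i : {poly K}) \is monic.
  by rewrite rpredM ?monicXn ?monic_exp ?monicXsubC.
by rewrite lead_coefE size_bdiffXn_term.
Qed.

Hypothesis charK0 : [pchar K] =i pred0.

(** Induction on a bound for the size: a multiple of ['X^(n.+1)] matches the top coefficient of [g],
    and the remainder is smaller. Dividing by [n.+1] is where characteristic zero enters. The
    existential is informative, so that its witness can serve to build data in [theorem1]. *)
Lemma bdiff_antidifference g :
  {p : {poly K} | size p = (size g).+1 & bdiff p = g}.
Proof.
move: {2}(size g) (leqnn (size g)) => n.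
elim: n g => [|n IHn] g le_g_n.
  move: le_g_n; rewrite leqn0 size_poly_eq0 => /eqP ->.
  (* The zero polynomial needs a nonzero constant here: the witness must have size 1, which excludes
     0. *)
  by exists 1; rewrite ?size_poly0 ?size_poly1 ?bdiffC.
have [/IHn //|lt_n_g] := leqP (size g) n.
have size_g : size g = n.+1 by apply/eqP; rewrite eqn_leq le_g_n lt_n_g.
have n1_neq0 : n.+1%:R != 0 :> K by rewrite ((pcharf0P K).1 charK0).
have gn_neq0 : g`_n != 0.
  by rewrite -[n in g`_n]/(n.+1.-1) -size_g lead_coef_eq0 -size_poly_gt0 size_g.
pose q : {poly K} := (g`_n / n.+1%:R) *: 'X^(n.+1).
have size_q : size q = n.+2.
  by rewrite size_scale ?size_polyXn // mulf_neq0 ?invr_eq0.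
have size_rem : (size (g - bdiff q)%R <= n)%N.
  apply/leq_sizeP => j; rewrite leq_eqVlt => /predU1P [<-|lt_n_j].
    by rewrite coefB bdiffZ coefZ coef_bdiffXn divfK ?subrr.
  rewrite coefB bdiffZ coefZ.
  rewrite (leq_sizeP _ _ (leqnn _)) ?(leq_trans le_g_n) //.
  by rewrite (leq_sizeP _ _ (size_bdiffXn n)) // mulr0 subrr.
have [p size_p bdiff_p] := IHn _ size_rem.
exists (q + p); last by rewrite bdiffD bdiff_p addrC subrK.
by rewrite size_polyDl size_q ?size_g // size_p.
Qed.

End BackwardDifference.

Lemma ge_int_ind (x : int) (P : int -> Prop) :
  P x -> (forall m, x < m -> P (m - 1) -> P m) -> forall m, x <= m -> P m.
Proof.
move=> Px PS m le_xm.
have -> : m = x + `|m - x|%N%:Z by lia.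
elim: `|m - x|%N => [|k IHk]; first by rewrite addr0.
by apply: PS; [lia | rewrite (_ : _ - 1 = x + k%:Z) //; lia].
Qed.

Section RecurrencePolynomial.

Variables (K : fieldType) (J : nat -> nat).
Variables (a : nat -> nat -> K) (b : nat -> nat -> int).

Definition rec_poly (f : nat -> {poly K}) n : {poly K} :=
  \sum_(1 <= i < n.+1) \sum_(j < J i)
    a i j *: (f (n - i)%N \Po ('X - (b i j)%:~R%:P)).

Lemma horner_rec_poly f n y :
  (rec_poly f n).[y] =
  \sum_(1 <= i < n.+1) \sum_(j < J i) a i j * (f (n - i)%N).[y - (b i j)%:~R].
Proof.
rewrite horner_sum; apply: eq_bigr => i _.
rewrite horner_sum; apply: eq_bigr => j _.
by rewrite hornerZ horner_comp_XsubC.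
Qed.

Lemma size_rec_poly (f : nat -> {poly K}) n :
    \sum_(j < J 1%N) a 1%N j != 0 ->
    (forall k, (k <= n)%N -> size (f k) = k.+1) ->
  size (rec_poly f n.+1) = n.+1.
Proof.
move=> a1_neq0 size_f.
rewrite /rec_poly big_ltn // subSS subn0.
set p1 := \sum_(j < J 1%N) _; set p2 := \sum_(2 <= i < _) _.
have size_p1 : size p1 = n.+1.
  apply/eqP; rewrite eqn_leq; apply/andP; split.
    apply: size_sum_leq => j _.
    by rewrite (leq_trans (size_scale_leq _ _)) // size_comp_XsubC size_f.
  (* Translation preserves leading coefficients, so no shift [b 1 j] affects the coefficient of
     degree [n]. *)
  rewrite ltnNge; apply/negP => /leq_sizeP/(_ n (leqnn n))/eqP.
  rewrite coef_sum (eq_bigr (fun j : 'I__ => a 1%N j * lead_coef (f n))).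
    rewrite -mulr_suml mulf_eq0 (negPf a1_neq0) lead_coef_eq0.
    by rewrite -size_poly_eq0 size_f.
  move=> j _; rewrite coefZ -(lead_coef_comp_XsubC _ (b 1%N j)%:~R).
  by rewrite lead_coefE size_comp_XsubC size_f.
(* For [i >= 2] the polynomial [f (n.+1 - i)] has size at most [n], so [p2] cannot cancel the top
   term of [p1]. *)
rewrite size_polyDl size_p1 // ltnS /p2 big_seq_cond; apply: size_sum_leq => i.
rewrite mem_index_iota andbT => i_range; apply: size_sum_leq => j _.
rewrite (leq_trans (size_scale_leq _ _)) // size_comp_XsubC size_f; lia.
Qed.

End RecurrencePolynomial.

Theorem theorem1 (K : fieldType) (charK0 : [pchar K] =i pred0)
    (x : nat -> int)
    (J : nat -> nat) (a : nat -> nat -> K) (b : nat -> nat -> int)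
    (F : nat -> int -> K) (c : K)
    (F_below : forall (n : nat) (m : int), m < x n -> F n m = 0)
    (F_rec : forall (n : nat) (m : int), x n < m ->
       F n m = F n (m - 1)
               + \sum_(1 <= i < n.+1) \sum_(j < J i)
                   a i j * F (n - i)%N (m - b i j))
    (a1_neq0 : \sum_(j < J 1%N) a 1%N j != 0)
    (c_neq0 : c != 0)
    (F0_const : forall m : int, x 0%N <= m -> F 0%N m = c)
    (b_le : forall n i j : nat, (1 <= n)%N -> (1 <= i <= n)%N -> (j < J i)%N ->
       b i j <= x n - x (n - i)%N + 1) :
  exists f : nat -> {poly K},
    (forall n : nat, size (f n) = n.+1) /\
    (forall (n : nat) (m : int), x n <= m -> F n m = (f n).[m%:~R]).
Proof.
pose spec n (p : {poly K}) :=
  size p = n.+1 /\ forall m : int, x n <= m -> F n m = p.[m%:~R].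
(* Families correct up to [n] suffice, and the diagonal is taken: [spec k] constrains only the
   [k]-th entry, so different stages need not agree. Keeping them in a sigma type avoids any appeal
   to choice. *)
suff fs n : {f : nat -> {poly K} | forall k, (k <= n)%N -> spec k (f k)}.
  exists (fun n => sval (fs n) n).
  by split=> n; have [] := svalP (fs n) n (leqnn n).
elim: n => [|n [f f_spec]].
  exists (fun=> c%:P) => k; rewrite leqn0 => /eqP ->.
  by split=> [|m /F0_const ->]; rewrite ?hornerC ?size_polyC ?c_neq0.
have size_g : size (rec_poly J a b f n.+1) = n.+1.
  by apply: size_rec_poly => // k /f_spec [].
have [p size_p bdiff_p] := bdiff_antidifference charK0 (rec_poly J a b f n.+1).
set X := x n.+1.
(* The added constant fits the initial value at [X]; it changes neither [bdiff p] nor the size, as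
   [p] has size [n.+2]. *)
pose q := p + (F n.+1 X - p.[X%:~R])%:P.
have bdiff_q : bdiff q = rec_poly J a b f n.+1.
  by rewrite bdiffD bdiffC addr0.
exists (fun k => if k == n.+1 then q else f k) => k.
rewrite leq_eqVlt ltnS; case: eqP => [-> _|_ /f_spec //].
split.
  by rewrite size_polyDl size_p size_g // (leq_ltn_trans (size_polyC_leq1 _)).
apply: ge_int_ind => [|m lt_Xm IHm].
  by rewrite /q hornerD hornerC addrC subrK.
have := horner_bdiff q m%:~R.
rewrite bdiff_q horner_rec_poly => /eqP; rewrite eq_sym subr_eq => /eqP ->.
rewrite F_rec // IHm rmorphB /= addrC; congr (_ + _).
apply: eq_big_nat => i i_range; apply: eq_bigr => j _.
(* The bound on [b i j] together with [X + 1 <= m] gives [x (n.+1 - i) <= m - b i j]; the [+ 1] in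
   the bound is absorbed by the strictness of [X < m]. *)
have [_ ->] : spec (n.+1 - i)%N (f (n.+1 - i)%N) by apply: f_spec; lia.
  by rewrite rmorphB.
have := @b_le n.+1 i j isT i_range (ltn_ord j).
rewrite -/X; lia.
Qed.
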